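(* Let $\beta>1$ be a simple Parry number with Rényi expansion of unity $d_\beta(1)=t_1t_2\cdots t_m$, $m\ge 2$, and let $u_\beta$ be the fixed point of the canonical substitution $\varphi$ associated with $\beta$. Then the factor complexity $\mathcal C$ of $u_\beta$ is an affine function (i.e. there are constants $a,b$ with $\mathcal C(n)=an+b$ for all $n\in\mathbb N$) if and only if both of the following hold: 1) $t_m=1$; 2) either $t_1\cdots t_{m-1}=w^k$ for some word $w$ and some integer $k\ge 2$, or no non-empty word is simultaneously a proper prefix and a proper suffix of the word $t_1t_2\cdots t_{m-1}$.
   Context: A simple Parry number is a real $\beta>1$ whose Rényi expansion of $1$ is finite: $d_\beta(1)=t_1\cdots t_m$ with nonnegative integer digits, $t_1=\lfloor\beta\rfloor\ge1$, $t_m\ge1$, $1=\sum_{i=1}^m t_i\beta^{-i}$. The digits satisfy the Parry condition: $t_it_{i+1}\cdots t_m0^\omega$ is lexicographically strictly smaller than $t_1\cdots t_m0^\omega$ for every $2\le i\le m$ (in particular $t_1\ge t_i$ for all $i$). The canonical substitution on the alphabet $\mathcal A=\{0,1,\dots,m-1\}$ is $\varphi(k)=0^{t_{k+1}}(k+1)$ for $0\le k\le m-2$ and $\varphi(m-1)=0^{t_m}$; it is primitive and $u_\beta=\lim_{n\to\infty}\varphi^n(0)$ is its unique fixed point. The factor complexity is $\mathcal C(n)=$ the number of distinct factors (finite contiguous subwords) of $u_\beta$ of length $n$. Words here are finite sequences of digits; $w^k$ denotes the concatenation of $k$ copies of $w$. *)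

(* Defs.v *)
From HB Require Import structures.
From mathcomp Require Import all_boot all_order all_algebra.
From mathcomp Require Import boolp reals.
Set Implicit Arguments. Unset Strict Implicit. Unset Printing Implicit Defensive.
Import Order.TTheory GRing.Theory Num.Theory.

(* Infinite words over nat are functions nat -> nat. *)

Definition lexlt (a b : nat -> nat) : Prop :=
  exists k, (forall j, j < k -> a j = b j) /\ a k < b k.

Definition pad0 (s : seq nat) : nat -> nat := fun j => nth 0 s j.

(* Parry condition on d = t_1 ... t_m (t is 0-indexed: t_i = nth 0 t (i-1)):
   t_i ... t_m 0^omega <_lex t_1 ... t_m 0^omega for every 2 <= i <= m. *)
Definition parry_cond (t : seq nat) : Prop :=
  forall i, 2 <= i <= size t -> lexlt (pad0 (drop i.-1 t)) (pad0 t).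

Definition renyi_expansion_of_one {R : realType} (beta : R) (t : seq nat) : Prop :=
  [/\ (1 < beta)%R,
      ((nth 0 t 0)%:R <= beta < (nth 0 t 0).+1%:R)%R,
      (1 <= nth 0 t 0) /\ (1 <= last 0 t),
      ((1 : R) = \sum_(i < size t) (nth 0 t i)%:R / beta ^+ i.+1)%R
    & parry_cond t].

Definition phi_letter (t : seq nat) (k : nat) : seq nat :=
  if k.+1 < size t then nseq (nth 0 t k) 0 ++ [:: k.+1]
  else nseq (nth 0 t k) 0.

Definition phi (t : seq nat) (w : seq nat) : seq nat :=
  flatten (map (phi_letter t) w).

(* u_beta = lim phi^n(0).  Since t_1 >= 1, phi^n(0) is a prefix of phi^{n+1}(0)
   and |phi^n(0)| >= n+1, so the i-th letter of the limit is the i-th letter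
   of phi^{i+1}(0). *)
Definition ubeta (t : seq nat) : nat -> nat :=
  fun i => nth 0 (iter i.+1 (phi t) [:: 0]) i.

Definition factor_at (u : nat -> nat) (n i : nat) : seq nat :=
  mkseq (fun j => u (i + j)) n.

(* factor complexity: number of distinct factors of length n of u_beta
   (all letters of u_beta lie in the alphabet 'I_m, m = size t). *)
Definition complexity (t : seq nat) (n : nat) : nat :=
  #|[set w : n.-tuple 'I_(size t) |
       `[< exists i, map val w = factor_at (ubeta t) n i >] ]|.

(* Main.v *)
Require Import Defs.
From HB Require Import structures.
From mathcomp Require Import all_boot all_order all_algebra.
From mathcomp Require Import boolp reals zify.
Import Order.TTheory GRing.Theory Num.Theory.

Set Implicit Arguments.
Unset Strict Implicit.
Unset Printing Implicit Defensive.

(** Write [N = m - 1] and let [p] be the least period of [t_1 ... t_N].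

    Every prefix of the fixed point [u] can be preceded by all [m] letters, and
    [C(0) = 1], [C(1) = m]; so [C] is affine iff no other factor of [u] is left
    special.  If [t_m >= 2], then [0^(t_1 + 1)] is left special but not a prefix.
    If [t_m = 1], the images of the letters form a suffix code, so a prefix [V]
    of [u] (followed there by [d]) with two occurrences preceded by distinct
    letters and followed by [c] and [c'] is the image of a shorter such
    configuration.  On the triples [(d, c, c')] this is a dynamics which only
    compares the numbers of zeros produced by the three letters; it starts from
    the triples [(0, k, l)] with [t_k <> t_l], and a left special non-prefix
    exists iff some [(d, e, e)] with [d <> e] is reached.

    The Parry condition makes [t_1 ... t_p] unbordered.  If [p] divides [N],
    which is what condition 2 says, the residues of [k] and [l] modulo [p] keep
    the mismatches apart; otherwise the orbit of a suitable triple ends in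
    [(p, 0, 0)]. *)

(** * Concatenations and runs of zeros in lists *)

Lemma cat_eq_cat (A : Type) (s1 s2 s3 s4 : seq A) :
  s1 ++ s2 = s3 ++ s4 ->
  (exists C, s1 = s3 ++ C /\ s4 = C ++ s2) \/
  (exists C, s3 = s1 ++ C /\ s2 = C ++ s4).
Proof.
elim: s1 s3 => [|x s1 IH] [|y s3] /=.
- by move=> ->; left; exists [::].
- by move=> ->; right; exists (y :: s3).
- by move=> <-; left; exists (x :: s1).
case=> <- /IH[[C [-> ->]]|[C [-> ->]]]; first by left; exists C.
by right; exists C.
Qed.

Lemma cat_eq_cat_cons (A : Type) (s1 s2 s3 s4 : seq A) (k : A) :
  s1 ++ s2 = s3 ++ k :: s4 ->
  (exists C, s1 = s3 ++ k :: C /\ s4 = C ++ s2) \/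
  (exists C, s3 = s1 ++ C /\ s2 = C ++ k :: s4).
Proof.
case/cat_eq_cat=> [[[|c C] [-> eC]]|[C [-> ->]]].
- by right; exists [::]; rewrite !cats0 eC.
- by case: eC => -> ->; left; exists C.
by right; exists C.
Qed.

Lemma cat_injl (A : Type) (s x y : seq A) : s ++ x = s ++ y -> x = y.
Proof. by elim: s => //= a s IH [/IH]. Qed.

Lemma cat_injr (A : Type) (s x y : seq A) : x ++ s = y ++ s -> x = y.
Proof.
elim/last_ind: s x y => [|s a IH] x y; first by rewrite !cats0.
by rewrite -!rcons_cat => /rcons_inj[/IH].
Qed.

Lemma nseqSr (A : Type) n (x : A) : nseq n.+1 x = rcons (nseq n x) x.
Proof. by elim: n => //= n {1}->. Qed.

Lemma trailing_zeros (x : seq nat) :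
  exists y i, x = y ++ nseq i 0 /\ (y = [::] \/ last 0 y != 0).
Proof.
elim/last_ind: x => [|x a [y [i [-> yP]]]].
  by exists [::], 0; split; [|left].
case: (eqVneq a 0) => [->|a0].
  by exists y, i.+1; rewrite nseqSr rcons_cat.
exists (rcons (y ++ nseq i 0) a), 0; rewrite cats0; split=> //; right.
by rewrite last_rcons.
Qed.

(** * Periods and borders under the Parry condition *)

Section Period.

Variables (T : nat -> nat) (N : nat).

Definition period p := 0 < p /\ forall i, i + p < N -> T (i + p) = T i.
Definition min_period p := period p /\ forall q, period q -> p <= q.

Lemma period_mul p a i : period p -> i + a * p < N -> T (i + a * p) = T i.
Proof.
move=> [p0 pP]; elim: a => [|a IH]; first by rewrite addn0.
rewrite mulSn [p + _]addnC addnA => h; rewrite pP //; apply: IH; lia.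
Qed.

Lemma period_mod p i : period p -> i < N -> T (i %% p) = T i.
Proof.
move=> pP iN; have := @period_mul p (i %/ p) (i %% p) pP.
by rewrite addnC -divn_eq => ->.
Qed.

Hypothesis N_gt0 : 0 < N.

Lemma min_period_exists : exists p, min_period p.
Proof.
have ex : exists p, `[< period p >].
  by exists N; apply/asboolP; split=> // i; lia.
exists (ex_minn ex); case: ex_minnP => p /asboolP pP p_min.
by split=> // q qP; apply: p_min; apply/asboolP.
Qed.

Lemma min_period_le p : min_period p -> p <= N.
Proof. by case=> _ p_min; apply: p_min; split=> // i; lia. Qed.

(* The form in which the Parry condition is used: where the word, shifted by
   [k], first departs from itself, it goes down. *)
Hypothesis T_parry : forall k d, 0 < k -> k + d < N ->
  (forall j, j < d -> T (k + j) = T j) -> T (k + d) <= T d.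

(** Given a border of length [r], the Parry inequalities for the shifts [r] and [p - r] give
    [T (r + j) = T j] by strong induction; then [p - r] is a smaller period. *)
Lemma min_period_unbordered p r :
  min_period p -> 0 < r < p -> ~ (forall i, i < r -> T (p - r + i) = T i).
Proof.
move=> mp /andP[r0 rp] rP; have pN := min_period_le mp.
case: mp => [[p0 pP] p_min].
have key j : p + j < N -> T (r + j) = T j.
  have [k] := ubnP j; elim: k j => // k IH j jk jN; apply/eqP.
  rewrite eqn_leq; apply/andP; split.
    by apply: T_parry => [//||i ij]; [lia | apply: IH; lia].
  rewrite -pP ?[j + p]addnC // [p + j](_ : _ = p - r + (r + j)); last lia.
  apply: T_parry => [||i ij]; [lia | lia |].
  case: (ltnP i r) => ir; first exact: rP.
  rewrite (_ : p - r + i = i - r + p); last lia.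
  rewrite pP; last lia.
  by rewrite -{2}(subnKC ir) IH //; lia.
have /p_min : period (p - r); last lia.
split=> [|i iN]; first lia.
case: (ltnP i r) => ir; first by rewrite addnC rP.
rewrite (_ : i + (p - r) = i - r + p); last lia.
rewrite pP; last lia.
by rewrite -key ?subnKC //; lia.
Qed.

(* Both alternatives of condition 2 amount to this divisibility. *)
Lemma min_period_dvd p : min_period p ->
  (exists2 h, period h & (h %| N) && (h + h <= N)) \/
  (forall r, 0 < r < N -> ~ (forall i, i < r -> T (N - r + i) = T i)) ->
  p %| N.
Proof.
move=> mp [[h hP /andP[hN h2]]|unb]; last first.
  have pN := min_period_le mp; move: pN; rewrite leq_eqVlt => /orP[/eqP->//|pN].
  (* If [p < N], the period [p] yields a border of length [N - p]. *)
  case: mp => [[p0 pP] _]; case: (unb (N - p)); first lia.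
  by move=> i iN; rewrite (_ : N - (N - p) + i = i + p) ?pP //; lia.
have ph := mp.2 _ hP; have p0 := mp.1.1.
apply: dvdn_trans hN; rewrite /dvdn; apply: contraT; rewrite -lt0n => r0.
have rp := ltn_pmod h p0.
(* A nonzero remainder of [h] gives the least period a border of length [p - h %% p]; [h + h <= N]
   keeps the indices in range. *)
case: (@min_period_unbordered p (p - h %% p) mp) => [|i ip]; first lia.
have e : T (i + h) = T i by apply: hP.2; lia.
rewrite -e (_ : p - (p - h %% p) + i = i + h %% p); last lia.
have eh : i + h = i + h %% p + h %/ p * p by have := divn_eq h p; lia.
by rewrite eh (period_mul mp.1) //; lia.
Qed.

Lemma dvd_min_period p : min_period p -> p %| N -> p < N \/
  (forall r, 0 < r < N -> ~ (forall i, i < r -> T (N - r + i) = T i)).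
Proof.
move=> mp pN; have := min_period_le mp; rewrite leq_eqVlt.
case/orP=> [/eqP pE|]; [right => r | by left].
by move: mp; rewrite pE; exact: min_period_unbordered.
Qed.

End Period.

(** * The substitution, its language and the prefixes of its fixed point *)

Section Language.

Variable t : seq nat.
Hypotheses (size_t : 2 <= size t) (t_head : 0 < nth 0 t 0).
Hypothesis t_last : 0 < last 0 t.

Notation N := (size t).-1.
Notation T := (nth 0 t).

Lemma T_last : T N = last 0 t.
Proof. by rewrite nth_last. Qed.

Lemma phi_cat x y : phi t (x ++ y) = phi t x ++ phi t y.
Proof. by rewrite /phi map_cat flatten_cat. Qed.

Lemma phi_cons k x : phi t (k :: x) = phi_letter t k ++ phi t x.
Proof. by []. Qed.

Lemma phi_letter_lt k : k < N -> phi_letter t k = rcons (nseq (T k) 0) k.+1.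
Proof.
move=> kN; rewrite /phi_letter (_ : k.+1 < size t); last lia.
by rewrite cats1.
Qed.

Lemma phi_letter_ge k : N <= k -> phi_letter t k = nseq (T k) 0.
Proof.
by move=> kN; rewrite /phi_letter (_ : k.+1 < size t = false) //; lia.
Qed.

(** The last letter of [phi_letter t a]: the substitution permutes last letters cyclically. *)
Definition cyc a := if a < N then a.+1 else 0.

Lemma phi_letter_last a :
  a <= N -> exists z, phi_letter t a = rcons z (cyc a).
Proof.
rewrite leq_eqVlt => /orP[/eqP->|aN]; rewrite /cyc.
  rewrite phi_letter_ge // ltnn T_last; case: (last 0 t) t_last => // r _.
  by exists (nseq r 0); rewrite nseqSr.
by rewrite phi_letter_lt // aN; exists (nseq (T a) 0).
Qed.

(** A nonzero letter [k] occurs in images only at the end of the image of [k.-1], so it marks a cut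
    between images. *)
Lemma phi_split X A k B :
  k != 0 -> phi t X = A ++ k :: B ->
  exists X1 X2, [/\ X = X1 ++ k.-1 :: X2, k.-1 < N,
    A = phi t X1 ++ nseq (T k.-1) 0 & B = phi t X2].
Proof.
move=> k0; elim: X A => [|x X IH] A; first by case: A.
have kn r C D : nseq r 0 = C ++ k :: D -> False.
  move=> e; have : k \in nseq r 0 by rewrite e mem_cat inE eqxx orbT.
  by rewrite mem_nseq (negbTE k0) andbF.
rewrite phi_cons => e0; have [[C [e ->]]|[C [-> e]]] := cat_eq_cat_cons e0.
  case: (ltnP x N) => xN; last by move: e; rewrite phi_letter_ge // => /kn.
  move: e; rewrite phi_letter_lt //; case/lastP: C => [|C c].
    rewrite cats1 => /rcons_inj[<- <-].
    by exists [::], X.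
  by rewrite -rcons_cons -rcons_cat => /rcons_inj[/kn].
have [X1 [X2 [-> kN -> ->]]] := IH _ e; exists (x :: X1), X2; split=> //.
by rewrite phi_cons catA.
Qed.

Definition word n := iter n (phi t) [:: 0].
Definition lang v := exists n A B, word n = A ++ v ++ B.
Definition pref v := exists n B, word n = v ++ B.

Lemma wordS n : word n.+1 = phi t (word n).
Proof. by []. Qed.

Lemma phi_bound X : all (leq^~ N) X -> all (leq^~ N) (phi t X).
Proof.
elim: X => //= x X IH /andP[xN /IH XN]; rewrite phi_cons all_cat XN andbT.
move: xN; rewrite leq_eqVlt => /orP[/eqP->|xN].
  by rewrite phi_letter_ge // all_nseq orbT.
by rewrite phi_letter_lt // all_rcons xN all_nseq orbT.
Qed.

Lemma word_bound n : all (leq^~ N) (word n).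
Proof. by elim: n => [//|n IH]; rewrite wordS phi_bound. Qed.

Lemma size_phi X : all (leq^~ N) X -> size X <= size (phi t X).
Proof.
elim: X => //= x X IH /andP[xN /IH XN]; rewrite phi_cons size_cat.
by have [z ->] := phi_letter_last xN; rewrite size_rcons; lia.
Qed.

Lemma phi0_cons : exists s z, phi_letter t 0 = 0 :: rcons s z.
Proof.
rewrite phi_letter_lt; last lia.
by case: (T 0) t_head => //= r _; exists (nseq r 0), 1.
Qed.

Lemma word_next n : exists r R, word n.+1 = word n ++ r :: R.
Proof.
elim: n => [|n [r [R IH]]].
  have [s [z e]] := phi0_cons; rewrite /word /= /phi /= cats0 e.
  by case: s {e} => [|y s]; [exists z, [::] | exists y, (rcons s z)].
rewrite wordS {1}IH phi_cat -wordS.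
have := size_phi (X := r :: R); have := word_bound n.+1.
rewrite IH all_cat => /andP[_ b] /(_ b).
by case: (phi t (r :: R)) => // r' R' _; exists r', R'.
Qed.

Lemma word_le n k : n <= k -> exists R, word k = word n ++ R.
Proof.
move/subnKC=> <-; elim: (k - n) => [|d [R IH]].
  by exists [::]; rewrite addn0 cats0.
have [r [R' e]] := word_next (n + d).
by exists (R ++ r :: R'); rewrite addnS e IH catA.
Qed.

Lemma size_word n : n < size (word n).
Proof.
elim: n => [//|n IH]; have [r [R ->]] := word_next n.
by rewrite size_cat /=; lia.
Qed.

Lemma word_head n : exists x, word n = 0 :: x.
Proof. by have [R ->] := word_le (leq0n n); exists R. Qed.

Lemma lang_word n : lang (word n).
Proof. by exists n, [::], [::]; rewrite cats0. Qed.

Lemma lang_sub A v B : lang (A ++ v ++ B) -> lang v.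
Proof.
by case=> n [A' [B' e]]; exists n, (A' ++ A), (B ++ B'); rewrite e -!catA.
Qed.

Lemma lang_catl A v : lang (A ++ v) -> lang v.
Proof. by move=> h; apply: (@lang_sub A _ [::]); rewrite cats0. Qed.

Lemma lang_catr v B : lang (v ++ B) -> lang v.
Proof. exact: (@lang_sub [::]). Qed.

Lemma lang_phi v : lang v -> lang (phi t v).
Proof.
case=> n [A [B e]]; exists n.+1, (phi t A), (phi t B).
by rewrite wordS e !phi_cat.
Qed.

Lemma lang_bound v : lang v -> all (leq^~ N) v.
Proof.
by case=> n [A [B e]]; have := word_bound n; rewrite e !all_cat => /and3P[].
Qed.

Lemma lang_desub v : lang v -> exists n A B, phi t (word n) = A ++ v ++ B.
Proof.
case=> n [A [B e]]; have [r [R e']] := word_next n.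
by exists n, A, (B ++ r :: R); rewrite -wordS e' e -!catA.
Qed.

Lemma lang_extr v : lang v -> exists z, lang (v ++ [:: z]).
Proof.
case=> n [A [[|b B] e]]; last first.
  by exists b, n, A, B; rewrite e -!catA.
have [r [R e']] := word_next n.
by exists r, n.+1, A, R; rewrite e' e cats0 -!catA.
Qed.

Lemma pref_lang v : pref v -> lang v.
Proof. by case=> n [B e]; exists n, [::], B. Qed.

Lemma pref_catr v B : pref (v ++ B) -> pref v.
Proof. by case=> n [B' e]; exists n, (B ++ B'); rewrite catA. Qed.

Lemma pref_phi v : pref v -> pref (phi t v).
Proof. by case=> n [B e]; exists n.+1, (phi t B); rewrite wordS e phi_cat. Qed.

Lemma pref_desub v : pref v -> exists n B, phi t (word n) = v ++ B.
Proof.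
case=> n [B e]; have [r [R e']] := word_next n.
by exists n, (B ++ r :: R); rewrite -wordS e' e -!catA.
Qed.

Lemma pref_extr v : pref v -> exists z, pref (v ++ [:: z]).
Proof.
case=> n [[|b B] e]; first last.
  by exists b, n, B; rewrite e -!catA.
have [r [R e']] := word_next n.
by exists r, n.+1, R; rewrite e' e cats0 -!catA.
Qed.

Lemma pref_nil : pref [::].
Proof. by exists 0, [:: 0]. Qed.

Lemma pref_size n : exists2 v, pref v & size v = n.
Proof.
elim: n => [|n [v /pref_extr[z vz] <-]]; first by exists [::]; [exact: pref_nil |].
by exists (v ++ [:: z]) => //; rewrite size_cat addn1.
Qed.

Lemma pref_uniq x y : pref x -> pref y -> size x = size y -> x = y.
Proof.
case=> n [B e] [k [C f]] xy.
have [R g] := word_le (leq_maxl n k); have [S h] := word_le (leq_maxr n k).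
have := eqseq_cat (B ++ R) (C ++ S) xy.
rewrite !catA -e -f -g -h eqxx; by move/esym/andP => [/eqP].
Qed.

Lemma pref_uniq_last v d e : pref (v ++ [:: d]) -> pref (v ++ [:: e]) -> d = e.
Proof.
move=> p q; have := pref_uniq p q; rewrite !size_cat => /(_ erefl) /cat_injl.
by case.
Qed.

(** * Left extensions and left special factors *)

Lemma cyc_le a : cyc a <= N.
Proof. by rewrite /cyc; case: ifP. Qed.

Lemma iter_cyc n a : a <= N -> iter n cyc a = (a + n) %% size t.
Proof.
move=> aN; elim: n => [|n IH] /=; first by rewrite addn0 modn_small; lia.
rewrite IH /cyc; have := ltn_pmod (a + n) (ltnW size_t).
rewrite addnS -[(a + n).+1]addn1 -(modnDml (a + n) 1).
move: ((a + n) %% size t) => r rs; case: ifP => h.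
  by rewrite addn1 modn_small; lia.
by rewrite (_ : r + 1 = size t) ?modnn //; lia.
Qed.

Lemma phi_last X a : a <= N -> exists Y, phi t (rcons X a) = rcons Y (cyc a).
Proof.
move=> aN; have [z e] := phi_letter_last aN.
exists (phi t X ++ z); rewrite -cats1 phi_cat.
by rewrite [phi t [:: a]]/phi /= cats0 e rcons_cat.
Qed.

Lemma word_last n : exists Y, word n = rcons Y (iter n cyc 0).
Proof.
elim: n => [|n [Y IH]]; first by exists [::].
rewrite wordS IH iterS; apply: phi_last.
by case: n {IH} => [//|n]; exact: cyc_le.
Qed.

(** After [size t] steps the last letter is 0 again, at the end of a word of length at least 2. *)
Lemma zero_preceded : exists2 a, a <= N & lang [:: a; 0].
Proof.
have [Y e] := word_last (size t); have := size_word (size t); move: e.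
rewrite iter_cyc // add0n modnn; case/lastP: Y => [-> /=|Y a e _]; first lia.
have h : lang (Y ++ [:: a; 0]).
  by have := lang_word (size t); rewrite e -!cats1 -catA.
exists a; last exact: lang_catl h.
by have := lang_bound (lang_catl h) => /= /andP[].
Qed.

Lemma lang_cons_phi a v : lang (a :: v) -> lang (cyc a :: phi t v).
Proof.
move=> h; have /= /andP[aN _] := lang_bound h.
move/lang_phi: h; rewrite phi_cons; have [z ->] := phi_letter_last aN.
by rewrite cat_rcons => /lang_catl.
Qed.

Lemma pref_left a v : a <= N -> pref v -> lang (a :: v).
Proof.
move=> aN [n0 [B e]]; have [a0 a0N h0] := zero_preceded.
have h n : lang (iter n cyc a0 :: word n).
  by elim: n => [//|n IH]; exact: lang_cons_phi.
(* Chosen so that [a0 + n] is congruent to [a] modulo [size t] and [n >= n0]. *)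
pose n := n0 * size t + (size t - a0 + a).
have [R eR] : exists R, word n = word n0 ++ R by apply: word_le; rewrite /n; nia.
have := h n; rewrite iter_cyc // eR e -!catA.
rewrite (_ : a0 + n = n0.+1 * size t + a); last by rewrite /n; lia.
by rewrite modnMDl modn_small; [move/(@lang_catr (a :: v)) | lia].
Qed.

Lemma lang_extl v : lang v -> exists2 a, a <= N & lang (a :: v).
Proof.
move=> [n [A [B e]]]; case/lastP: A e => [|A a] e.
  by exists 0 => //; apply: pref_left => //; exists n, B.
have h : lang (a :: v).
  by exists n, A, B; rewrite e cat_rcons.
by exists a => //; have /= /andP[] := lang_bound h.
Qed.

(** Desubstitution: [k.+1] is preceded by 0 if [T k > 0], and otherwise by [cyc x], where [x]
    precedes [k]. *)
Lemma lang_pair_lt a k : k != 0 -> lang [:: a; k] -> a < k.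
Proof.
elim: k a => // k IH a k0 /lang_desub[n [A [B]]].
rewrite -cat1s -!catA /= => e.
have [||X1 [X2 [eX kN eA _]]] := @phi_split (word n) (A ++ [:: a]) k.+1 B.
- by [].
- by rewrite e -catA.
move: eX eA => /= eX; case: (posnP (T k)) => Tk; last first.
  by rewrite -(prednK Tk) -addn1 nseqD catA !cats1 => /rcons_inj[_ ->].
rewrite Tk cats0; case/lastP: X1 eX => [_|X1 x eX].
  by case: A {e}.
have h : lang [:: x; k].
  by exists n, X1, X2; rewrite eX cat_rcons.
have /= /andP[xN _] := lang_bound h.
have [Y ->] := phi_last X1 xN; rewrite cats1 => /rcons_inj[_ ->].
rewrite /cyc; case: ifP => // _; rewrite ltnS; apply: IH => //.
by apply/eqP => kE; move: Tk t_head; rewrite kE => ->.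
Qed.

Lemma lang_after_N A z B : lang (A ++ N :: z :: B) -> z = 0.
Proof.
move=> h; have h2 : lang [:: N; z] by apply: (@lang_sub A _ B).
apply/eqP; apply: contraT => z0; have := lang_pair_lt z0 h2.
by have /= := lang_bound h2; lia.
Qed.

Definition left_special_pref :=
  forall (a b : nat) (v : seq nat),
  a != b -> lang (a :: v) -> lang (b :: v) -> pref v.

Lemma pref_phi0 : pref (nseq (T 0) 0 ++ [:: 1]).
Proof.
have : pref (phi t [:: 0]) by apply: pref_phi; exists 0, [::].
by rewrite /phi /= cats0 phi_letter_lt ?cats1 //; lia.
Qed.

Lemma pref_zeros s : s < T 0 -> pref (nseq s 0 ++ [:: 0]).
Proof.
move=> sT; rewrite cats1 -nseqSr; have := pref_phi0.
by rewrite -(subnKC sT) nseqD -catA; exact: pref_catr.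
Qed.

Lemma left_special_pref_last : left_special_pref -> last 0 t = 1.
Proof.
move=> LSP; apply/eqP; rewrite eqn_leq t_last andbT leqNgt; apply/negP => t2.
have h : lang (N :: [:: 0]) by apply: pref_left => //; exists 0, [::].
have [a aN h3] := lang_extl h.
have {aN} aN : a < N.
  rewrite ltn_neqAle aN andbT; apply/eqP => aE; move: h3; rewrite aE.
  by move/(@lang_after_N [::]); lia.
(* The image of [a N 0] has [last 0 t + T 0] zeros after [a.+1], so [0^(T 0 + 1)] is preceded both
   by [a.+1] and by 0. *)
have : lang (a.+1 :: nseq (T 0).+2 0).
  have := lang_cons_phi h3; rewrite /cyc aN /phi /= cats0 phi_letter_ge //.
  rewrite phi_letter_lt; last lia.
  rewrite T_last -cats1 catA -nseqD.
  rewrite (_ : last 0 t + T 0 = (T 0).+2 + (last 0 t - 2)); last lia.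
  by rewrite nseqD -catA; exact: (@lang_catr (a.+1 :: nseq (T 0).+2 0)).
move=> h4; have h5 := @lang_catl [:: a.+1] _ h4.
have : pref (nseq (T 0).+1 0).
  apply: (LSP a.+1 0) => //.
  move: h4; rewrite [nseq _.+2 _]nseqSr -cats1.
  exact: (@lang_catr (a.+1 :: nseq (T 0).+1 0)).
by rewrite nseqSr -cats1 => /(pref_uniq_last pref_phi0).
Qed.

(** * Complexity counted by left extensions *)

Lemma ubeta_word n i : i < size (word n) -> ubeta t i = nth 0 (word n) i.
Proof.
move=> iw; rewrite /ubeta -/(word i.+1).
have iw' := ltnW (size_word i.+1).
case: (leqP n i.+1) => h.
  by have [R ->] := word_le h; rewrite nth_cat iw.
by have [R ->] := word_le (ltnW h); rewrite nth_cat iw'.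
Qed.

Lemma lang_factor v : lang v <-> exists i, v = factor_at (ubeta t) (size v) i.
Proof.
split=> [[n [A [B e]]]|[i vE]].
  exists (size A); apply: (@eq_from_nth _ 0); rewrite ?size_mkseq // => j jv.
  rewrite nth_mkseq // (@ubeta_word n); last by rewrite e !size_cat; lia.
  by rewrite e nth_cat ltnNge leq_addr addKn nth_cat jv.
have [n nv] : exists n, i + size v < size (word n).
  by exists (i + size v); exact: size_word.
have -> : v = take (size v) (drop i (word n)).
  apply: (@eq_from_nth _ 0) => [|j jv].
    by rewrite size_takel // size_drop; lia.
  by rewrite {1}vE nth_mkseq // nth_take // nth_drop; apply: ubeta_word; lia.
exists n, (take i (word n)), (drop (size v) (drop i (word n))).
by rewrite !cat_take_drop.
Qed.

Lemma tuple_of_bounded v :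
  all (leq^~ N) v -> exists w : (size v).-tuple 'I_(size t), map val w = v.
Proof.
elim: v => [|a v IH] /=; first by exists [tuple].
case/andP=> aN /IH[w wE]; have am : a < size t by lia.
by exists [tuple of Ordinal am :: w]; rewrite /= wE.
Qed.

Definition factors n := [set w : n.-tuple 'I_(size t) | `[< lang (map val w) >]].

Definition left_exts n (v : n.-tuple 'I_(size t)) :=
  [set a : 'I_(size t) | `[< lang (val a :: map val v) >]].

Lemma complexityE n : complexity t n = #|factors n|.
Proof.
apply: eq_card => w; rewrite !inE; apply: asbool_equiv_eq.
by rewrite lang_factor size_map size_tuple.
Qed.

Lemma card_factorsS n :
  #|factors n.+1| = \sum_(v in factors n) #|left_exts v|.
Proof.
rewrite -sum1_card (partition_big (fun w : n.+1.-tuple _ => behead_tuple w)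
  (fun v => v \in factors n)) /=.
  apply: eq_bigr => v _; rewrite sum1dep_card.
  rewrite -(card_imset _ (f := fun a => cons_tuple a v)); last first.
    by move=> a b /(congr1 val) [].
  apply: eq_card => w; rewrite [LHS]inE; apply/andP/imsetP.
    case: (tupleP w) => a u [hw /eqP uv]; exists a.
      by move: hw; rewrite !inE -uv; congr (`[< lang _ >]).
    by rewrite -uv; apply: val_inj.
  case=> a; rewrite inE => ha ->; split; first by rewrite inE.
  by apply/eqP/val_inj.
move=> w; rewrite !inE; case: (tupleP w) => a u /asboolP h.
by apply/asboolP; exact: (@lang_catl [:: val a]).
Qed.

Lemma card_left_exts_pref n (v : n.-tuple 'I_(size t)) :
  pref (map val v) -> #|left_exts v| = N.+1.
Proof.
move=> pv; rewrite prednK; last lia.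
rewrite -[RHS]card_ord -cardsT; apply: eq_card => a; rewrite !inE.
apply/asboolP/pref_left => //.
by rewrite -ltnS prednK ?(ltnW size_t) //; exact: ltn_ord.
Qed.

Lemma card_left_exts_gt0 n (v : n.-tuple 'I_(size t)) :
  v \in factors n -> 0 < #|left_exts v|.
Proof.
rewrite inE => /asboolP/lang_extl[a aN h]; have am : a < size t by lia.
by apply/card_gt0P; exists (Ordinal am); rewrite inE; apply/asboolP.
Qed.

(** The prefix of length [n] has all [N.+1] left extensions and every other factor at least one; the
    last sum measures the left special non-prefixes. *)
Lemma complexityS n : exists2 p : n.-tuple 'I_(size t), pref (map val p) &
  complexity t n.+1 =
    complexity t n + N + \sum_(v in factors n | v != p) #|left_exts v|.-1.
Proof.
have [v pv vn] := pref_size n.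
have [w wE] := tuple_of_bounded (lang_bound (pref_lang pv)).
move: w wE; rewrite vn => p pE; exists p; rewrite ?pE //.
have pF : p \in factors n by rewrite inE pE; apply/asboolP; exact: pref_lang.
rewrite !complexityE card_factorsS (bigD1 p) //= card_left_exts_pref ?pE //.
have -> : #|factors n| = (\sum_(u in factors n | u != p) 1).+1.
  by rewrite -sum1_card (bigD1 p).
have -> : \sum_(u in factors n | u != p) #|left_exts u| =
    \sum_(u in factors n | u != p) 1 +
    \sum_(u in factors n | u != p) #|left_exts u|.-1;
  last by rewrite addnA !addSn [N + _]addnC.
rewrite -big_split /=; apply: eq_bigr => u /andP[uF _].
by rewrite add1n prednK // card_left_exts_gt0.
Qed.

Lemma left_special_pref_complexity :
  left_special_pref <->
  forall n, complexity t n.+1 = complexity t n + N.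
Proof.
split=> [LSP n|H a b v ab ha hb].
  have [p pp ->] := complexityS n; rewrite big1 ?addn0 // => v /andP[vF vp].
  apply/eqP; rewrite -subn1 subn_eq0 leqNgt; apply: contra vp.
  case/card_gt1P=> a [b []]; rewrite !inE => /asboolP ha /asboolP hb ab.
  apply/eqP/val_inj/(inj_map val_inj); apply: pref_uniq => //.
    exact: LSP ha hb.
  by rewrite !size_map !size_tuple.
have bv : all (leq^~ N) v by have /= /andP[] := lang_bound ha.
have [w wE] := tuple_of_bounded bv; have [p pp] := complexityS (size v).
rewrite H => e; case: (eqVneq w p) => [wp|wp]; first by rewrite -wE wp.
have {e} /eqP :
  \sum_(u in factors (size v) | u != p) #|left_exts u|.-1 = 0 by lia.
rewrite sum_nat_eq0 => /forallP/(_ w); rewrite wp andbT inE.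
rewrite wE (_ : `[< lang v >]); last by apply/asboolP; exact: (@lang_catl [:: a]).
have /= /andP[aN _] := lang_bound ha; have /= /andP[bN _] := lang_bound hb.
have am : a < size t by lia.
have bm : b < size t by lia.
have : 1 < #|left_exts w|; last by case: #|_| => [|[]].
apply/card_gt1P; exists (Ordinal am), (Ordinal bm).
by split; rewrite ?inE ?wE //; apply/asboolP.
Qed.

Lemma complexity0 : complexity t 0 = 1.
Proof.
rewrite complexityE -(expn0 (size t)) -[X in X ^ _]card_ord -card_tuple -cardsT.
apply: eq_card => w; rewrite !inE tuple0; apply/asboolP.
by apply: pref_lang; exact: pref_nil.
Qed.

Lemma complexity1 : complexity t 1 = N.+1.
Proof.
have [p _ ->] := complexityS 0; rewrite complexity0 big1 ?addn0 ?add1n // => v.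
by case/andP=> _ /eqP[]; rewrite (tuple0 v) (tuple0 p).
Qed.

(** The values 1 and [N.+1] at lengths 0 and 1 force the slope [N]. *)
Lemma affine_complexity :
  (exists a b : int, forall n : nat,
      ((complexity t n)%:Z = a * n%:Z + b)%R) <-> left_special_pref.
Proof.
rewrite left_special_pref_complexity; split=> [[a [b H]] n|H].
  by have := H 0; have := H 1; have := H n; have := H n.+1;
    rewrite complexity0 complexity1; nia.
exists N%:Z%R, 1%R; elim=> [|n IH]; first by rewrite complexity0 mulr0 add0r.
by rewrite H; lia.
Qed.

(** * Runs of zeros in images, and desubstitution when the last digit is 1 *)

Lemma nseq0_cmp r s x c A B :
  x != 0 -> nseq r 0 ++ x :: A = nseq s 0 ++ c :: B ->
  s <= r /\ c = if r == s then x else 0.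
Proof.
move=> x0; elim: r s => [|r IH] [|s] //=; first by case.
- by case=> e; rewrite e eqxx in x0.
- by case.
by case=> /IH[sr ->]; split.
Qed.

Lemma nseq0_cut r s x A :
  s <= r -> exists B,
  nseq r 0 ++ x :: A = nseq s 0 ++ (if r == s then x else 0) :: B.
Proof.
move/subnKC <-; case: (r - s) => [|q].
  by exists A; rewrite addn0 eqxx.
exists (nseq q 0 ++ x :: A).
by rewrite nseqD -catA /= (_ : s + q.+1 == s = false) //; lia.
Qed.

(* [N] is always followed by [0] and, when the last digit is 1, is mapped to
   the single letter [0]; hence the effective number of zeros it produces. *)
Definition zeros c := if c < N then T c else (T 0).+1.
Definition after c := if c < N then c.+1 else 1.
(** The letter read after [s] zeros from the start of the image of [c]; meaningful for
    [s <= zeros c]. *)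
Definition next s c := if zeros c == s then after c else 0.

Hypothesis t_last1 : last 0 t = 1.

Lemma phi_letter_N : phi_letter t N = [:: 0].
Proof. by rewrite phi_letter_ge // T_last t_last1. Qed.

(** [Y], empty or ending in a nonzero letter, stops at a cut, so the zeros after it are counted by
    [zeros z] for the next letter [z]. *)
Lemma parse n Y s c B :
  phi t (word n) = Y ++ nseq s 0 ++ c :: B -> Y = [::] \/ last 0 Y != 0 ->
  exists X1 z X2, [/\ word n = X1 ++ z :: X2, phi t X1 = Y, s <= zeros z
                    & c = next s z].
Proof.
move=> e YP.
have [X1 [X2 [eX eY e2]]] : exists X1 X2,
    [/\ word n = X1 ++ X2, phi t X1 = Y & phi t X2 = nseq s 0 ++ c :: B].
  case: YP => [Y0|]; first by exists [::], (word n); rewrite e Y0.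
  case/lastP: Y e => [//|Y k]; rewrite last_rcons cat_rcons => e k0.
  have [X1 [X2 [eX kN eA eB]]] := phi_split k0 e.
  exists (rcons X1 k.-1), X2; split=> //; first by rewrite eX cat_rcons.
  rewrite -cats1 phi_cat eA [phi t [:: _]]/phi /= cats0 phi_letter_lt //.
  by rewrite prednK ?lt0n // rcons_cat.
have bX : all (leq^~ N) X2.
  by have := word_bound n; rewrite eX all_cat => /andP[].
case: X2 eX e2 bX => [|z X2] eX e2 /=; first by case: s e2 {e}.
case/andP=> zN _; exists X1, z, X2.
move: zN e2; rewrite leq_eqVlt phi_cons /next /zeros /after.
case/orP=> [/eqP zN|zN]; last first.
  rewrite phi_letter_lt // zN cat_rcons => /nseq0_cmp[//|sT ->].
  by split.
(* For [z = N] the image is a single 0; the next letter is 0 and adds [T 0] zeros. *)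
subst z; rewrite ltnn phi_letter_N; case: s e => [|s] e /=.
  by case=> <- _; split.
case; case: X2 eX => [|z' X2] eX; first by case: s {e}.
have z0 : z' = 0.
  by apply: (@lang_after_N X1 z' X2); rewrite -eX; exact: lang_word.
subst z'; rewrite phi_cons phi_letter_lt; last lia.
rewrite cat_rcons => /nseq0_cmp[//|sT ->].
by split.
Qed.

Lemma cyc_inj x y : x <= N -> y <= N -> cyc x = cyc y -> x = y.
Proof. by rewrite /cyc; case: ltnP => hx; case: ltnP => hy; lia. Qed.

(* As the last digit is 1, the last letter of [phi_letter t a] determines [a]:
   the images of the letters form a suffix code. *)
Lemma phi_suffix X A V :
  all (leq^~ N) X -> all (leq^~ N) V -> phi t X = A ++ phi t V ->
  exists X', X = X' ++ V /\ phi t X' = A.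
Proof.
elim/last_ind: V X => [|V v IH] X.
  by rewrite cats0 => _ _ <-; exists X; rewrite cats0.
case/lastP: X => [_|X x].
  rewrite all_rcons => /andP[vN _]; have [Y ->] := phi_last V vN.
  by move/(congr1 size); rewrite size_cat size_rcons addnS.
rewrite !all_rcons => /andP[xN XN] /andP[vN VN] e.
have xv : x = v.
  apply: cyc_inj => //; have [Y eY] := phi_last V vN.
  have [Z eZ] := phi_last X xN.
  by move: e; rewrite eY eZ -rcons_cat => /rcons_inj[].
move: e; rewrite xv -!cats1 !phi_cat catA => /cat_injr/(IH _ XN VN)[X' [-> <-]].
by exists X'; rewrite catA.
Qed.

(** The nonzero end of [a :: phi t V] is a cut, from which the suffix code recovers [V] and the
    letter before it. For empty [V] the cut is at [a] itself. *)
Lemma lang_desub_step a V s c :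
  all (leq^~ N) V -> last a (phi t V) != 0 ->
  lang (a :: phi t V ++ nseq s 0 ++ [:: c]) ->
  exists a' z, [/\ a' <= N, a = cyc a', lang (a' :: V ++ [:: z]),
                   s <= zeros z & c = next s z].
Proof.
move=> VN l0 /lang_desub[n [A [B]]] e.
have [||X1 [z [X2 [eX eY sz cE]]]] :=
  @parse n (A ++ a :: phi t V) s c B.
- by rewrite e /= -!catA.
- by right; rewrite last_cat.
have bX : all (leq^~ N) X1.
  by have := word_bound n; rewrite eX all_cat => /andP[].
move: eY; rewrite -cat_rcons => /(phi_suffix bX VN)[X' [eX1 eA]].
case/lastP: X' eX1 eA => [_|X' a' eX1]; first by case: A {e}.
have a'N : a' <= N.
  by move: bX; rewrite eX1 all_cat all_rcons => /andP[/andP[]].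
have [Y ->] := phi_last X' a'N => /rcons_inj[_ <-].
exists a', z; split=> //; exists n, X', X2.
by rewrite eX eX1 /= cat_rcons -!catA.
Qed.

Lemma phi_eq0 V : all (leq^~ N) V -> phi t V = [::] -> V = [::].
Proof. by move/size_phi=> h e; apply/nilP; move: h; rewrite e leqn0. Qed.

Lemma pref_desub_step Y s d :
  Y = [::] \/ last 0 Y != 0 -> pref (Y ++ nseq s 0 ++ [:: d]) ->
  exists V z, [/\ Y = phi t V, pref (V ++ [:: z]), s <= zeros z & d = next s z].
Proof.
move=> YP /pref_desub[n [B]] e.
have [||X1 [z [X2 [eX eY sz cE]]]] := @parse n Y s d B => //.
  by rewrite e -!catA.
by exists X1, z; split=> //; exists n, X2; rewrite eX -catA.
Qed.

(** [E] is empty unless [c = N], where it is the forced next letter 0. *)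
Lemma zeros_cut c s :
  c <= N -> s <= zeros c ->
  exists E B, (forall A, lang (A ++ [:: c]) -> lang (A ++ c :: E)) /\
   (forall A, pref (A ++ [:: c]) -> pref (A ++ c :: E)) /\
   phi t (c :: E) = nseq s 0 ++ next s c :: B.
Proof.
rewrite leq_eqVlt /next /after /zeros => /orP[/eqP->|cN].
  rewrite ltnn => /(nseq0_cut 1 [::])[B eB].
  exists [:: 0], B; split=> [A /lang_extr[z]|].
    by rewrite -catA => h; rewrite -(@lang_after_N A z [::]).
  split=> [A /pref_extr[z]|].
    by rewrite -catA => h; rewrite -(@lang_after_N A z [::]) //; exact: pref_lang h.
  rewrite phi_cons phi_letter_N -eB /phi /= cats0 phi_letter_lt ?cats1 //; lia.
rewrite cN => /(nseq0_cut c.+1 [::])[B eB].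
by exists [::], B; do !split=> //; rewrite /phi /= cats0 phi_letter_lt // -cats1.
Qed.

Lemma lang_step a V s c :
  lang (a :: V ++ [:: c]) -> s <= zeros c ->
  lang (cyc a :: phi t V ++ nseq s 0 ++ [:: next s c]).
Proof.
move=> h sc; have cN : c <= N.
  by have := lang_bound h; rewrite /= all_cat /= => /and4P[].
have [E [B [hE [_ e]]]] := zeros_cut cN sc.
have := lang_cons_phi (hE (a :: V) h); rewrite phi_cat e => h'.
by apply: (@lang_catr _ B); rewrite /= -!catA.
Qed.

Lemma pref_step V s d :
  pref (V ++ [:: d]) -> s <= zeros d ->
  pref (phi t V ++ nseq s 0 ++ [:: next s d]).
Proof.
move=> h sc; have cN : d <= N.
  by have := lang_bound (pref_lang h); rewrite /= all_cat /= => /and3P[].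
have [E [B [_ [hE e]]]] := zeros_cut cN sc.
have := pref_phi (hE V h); rewrite phi_cat e => h'.
by apply: (@pref_catr _ B); rewrite /= -!catA.
Qed.

(** * Branching triples *)

(* [V] is a prefix of the fixed point followed there by [d], with two further
   occurrences preceded by distinct letters and followed by [c] and [c']. *)
Definition branch d c c' := exists (a b : nat) (V : seq nat),
  [/\ a != b, lang (a :: V ++ [:: c]), lang (b :: V ++ [:: c'])
    & pref (V ++ [:: d])].

Lemma branch_sym d c c' : branch d c c' -> branch d c' c.
Proof. by case=> a [b [V [ab h1 h2 h3]]]; exists b, a, V; rewrite eq_sym. Qed.

Lemma branch_step s d c c' :
  s <= zeros d -> s <= zeros c -> s <= zeros c' ->
  branch d c c' -> branch (next s d) (next s c) (next s c').
Proof.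
move=> sd sc sc' [a [b [V [ab h1 h2 h3]]]].
exists (cyc a), (cyc b), (phi t V ++ nseq s 0); rewrite -!catA; split.
- have /= /andP[aN _] := lang_bound h1; have /= /andP[bN _] := lang_bound h2.
  by apply: contra ab => /eqP/(cyc_inj aN bN)->.
- exact: lang_step.
- exact: lang_step.
- exact: pref_step.
Qed.

(** A shortest left special non-prefix is [v e], where [v] is a prefix followed in the fixed point
    by some [d] other than [e]. *)
Lemma left_special_prefP :
  left_special_pref <-> forall d e, branch d e e -> d = e.
Proof.
split=> [LSP d e [a [b [V [ab h1 h2 h3]]]]|H a b v ab].
  exact: pref_uniq_last h3 (LSP _ _ _ ab h1 h2).
elim/last_ind: v => [|v e IH]; first by move=> _ _; exact: pref_nil.
rewrite -cats1 => h1 h2; have [] := @pref_extr v.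
  by apply: IH; [move: h1 | move: h2]; rewrite -cat_cons; exact: lang_catr.
by move=> d h3; rewrite -(H d e) //; exists a, b, v.
Qed.

Lemma branch_init k l :
  k < N -> l < N -> T k < T l -> T l <= T 0 -> branch 0 k.+1 l.+1.
Proof.
move=> kN lN kl l0.
have [a aN ha] : exists2 a, a < N & lang [:: a; k].
  case: (posnP k) => [->|k0].
    by exists 0; [lia | apply: pref_left => //; exists 0, [::]].
  have [|a aN ha] := @lang_extl [:: k].
    by apply: pref_left; [lia | exact: pref_nil].
  exists a => //; rewrite ltn_neqAle aN andbT; apply/eqP => aE; move: ha.
  by rewrite aE => /(@lang_after_N [::]); lia.
(* The word [0^(T k)] follows [a.+1] in the image of [a k], follows 0 in that of [l], and continues
   with 0 in the fixed point as [T k < T 0]. *)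
exists a.+1, 0, (nseq (T k) 0); split=> //.
- have := lang_cons_phi ha; rewrite /cyc aN /phi /= cats0.
  by rewrite phi_letter_lt // -cats1.
- have : lang (phi t [:: l]).
    by apply: lang_phi; apply: pref_left; [lia | exact: pref_nil].
  rewrite /phi /= cats0 phi_letter_lt // -cats1 -(subnK kl) nseqD -catA.
  by move/lang_catl.
- by apply: pref_zeros; lia.
Qed.

(** Extending the run leftwards to a nonzero letter or to the start adds [i] zeros and reaches a
    cut. *)
Lemma zero_run r c :
  lang (nseq r 0 ++ [:: c]) ->
  exists z i, [/\ z <= N, i + r <= zeros z & c = next (i + r) z].
Proof.
case/lang_desub=> n [A [B e]]; have [Y [i [eA YP]]] := trailing_zeros A.
have [||X1 [z [X2 [eX _ sz cE]]]] := @parse n Y (i + r) c B => //.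
  by rewrite e eA nseqD -!catA.
exists z, i; split=> //.
by have := word_bound n; rewrite eX all_cat /= => /and3P[].
Qed.

(** A non-empty prefix starts with 0, whose image has at least two letters; so desubstitution
    shortens it. *)
Lemma pref_phi_size V : pref V -> V != [::] -> size V < size (phi t V).
Proof.
move=> h; have := lang_bound (pref_lang h); case: V h => // x V [n [B]].
have [y ->] := word_head n; case=> <- _ /= VN _.
have [s [z e]] := phi0_cons; rewrite phi_cons e /= size_cat size_rcons.
by have := size_phi VN; lia.
Qed.

(** * Induction over branching triples by desubstitution *)

Section BranchInduction.

Variable G : nat -> nat -> nat -> Prop.
Hypothesis T_max : forall i, i < N -> T i <= T 0.
Hypothesis G_sym : forall d c c', G d c c' -> G d c' c.
Hypothesis G_refl : forall d c, G d d c.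
Hypothesis G_init : forall k l, k < N -> l < N -> T k <> T l -> G 0 k.+1 l.+1.
Hypothesis G_step : forall s d c c', d <= N -> c <= N -> c' <= N ->
  s <= zeros d -> s <= zeros c -> s <= zeros c' ->
  G d c c' -> G (next s d) (next s c) (next s c').

Let lang_letter a V z : lang (a :: V ++ [:: z]) -> z <= N.
Proof. by move/lang_bound; rewrite /= all_cat /= => /and4P[]. Qed.

Let pref_letter V z : pref (V ++ [:: z]) -> z <= N.
Proof. by move/pref_lang/lang_bound; rewrite /= all_cat /= => /and3P[]. Qed.

Let pref0 z : pref [:: z] -> z = 0.
Proof. by move=> h; apply: (@pref_uniq_last [::]) => //; exists 0, [::]. Qed.

(** The first occurrence lies in a run of at least [s.+1] zeros, the second follows a cut; they have
    no common preimage, and the triple is trivial or initial. *)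
Lemma branch_ind_unaligned b s d c c' :
  b != 0 -> lang (0 :: nseq s 0 ++ [:: c]) -> lang (b :: nseq s 0 ++ [:: c']) ->
  pref (nseq s 0 ++ [:: d]) -> G d c c'.
Proof.
move=> b0 /(@zero_run s.+1)[z [i [zN sz cE]]] h2 h3.
have [|V [z0 [/esym eV h0 s0 dE]]] := @pref_desub_step [::] s d _ h3.
  by left.
have {eV} V0 : V = [::].
  apply: phi_eq0 eV; have := lang_bound (pref_lang h0).
  by rewrite all_cat => /andP[].
move: h0 s0 dE; rewrite V0 => /pref0 ->.
have [//|b' [z' [_ _ h2' sz' cE']]] := @lang_desub_step b [::] s c' _ b0 h2.
have N0 : 0 < N by lia.
rewrite /next {1 2}/zeros N0 /after N0 => s0.
case: eqP => [sT ->|sT ->].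
  (* A run longer than [T 0] comes only from [N] and is followed by 1, which is also [d]. *)
  have -> : c = 1; last exact: G_refl.
  rewrite cE /next /after; move: sz; rewrite /zeros; case: ltnP => zN'.
    by have := T_max zN'; lia.
  by move=> h; rewrite (_ : (T 0).+1 == i + s.+1) //; lia.
case: (eqVneq c 0) => [->|c0]; first exact: G_refl.
case: (eqVneq c' 0) => [->|c'0]; first by apply: G_sym; exact: G_refl.
move: c0 c'0; rewrite cE cE' /next; case: (zeros z =P _) => // ez _.
case: (zeros z' =P s) => // ez' _; move: ez ez'; rewrite /after /zeros.
case: (ltnP z') => hz'; last lia.
(* If [z = N], then [c = 1] and the initial triple has [k = 0]; [s < T 0] keeps the digits
   distinct. *)
case: (ltnP z) => hz ez ez'; apply: G_init => //; lia.
Qed.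

(** Desubstitution lowers both left letters until one of them is 0. *)
Lemma branch_ind_zeros a b s d c c' :
  a != b -> lang (a :: nseq s 0 ++ [:: c]) -> lang (b :: nseq s 0 ++ [:: c']) ->
  pref (nseq s 0 ++ [:: d]) -> G d c c'.
Proof.
elim: a b s d c c' => [|a IH] b s d c c' ab h1 h2 h3.
  by apply: branch_ind_unaligned h1 h2 h3; rewrite eq_sym.
case: b ab h2 => [_|b ab] h2.
  by apply: G_sym; exact: branch_ind_unaligned h2 h1 h3.
have [//|//|a' [z [a'N aE h1' sz cE]]] := @lang_desub_step a.+1 [::] s c _ _ h1.
have [//|//|b' [z' [b'N bE h2' sz' cE']]] := @lang_desub_step b.+1 [::] s c' _ _ h2.
have [|V [z0 [/esym eV h0 s0 dE]]] := @pref_desub_step [::] s d _ h3.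
  by left.
have V0 : V = [::].
  apply: phi_eq0 eV; have := lang_bound (pref_lang h0).
  by rewrite all_cat => /andP[].
rewrite V0 in h0; rewrite dE cE cE'; apply: G_step => //.
- exact: (@pref_letter [::]).
- exact: (@lang_letter _ [::] _ h1').
- exact: (@lang_letter _ [::] _ h2').
move: aE bE; rewrite /cyc; do 2 case: ifP => // _; case=> aE; case=> bE.
by apply: (IH b 0) => //; rewrite ?aE ?bE.
Qed.

(** Without its trailing zeros, [V] is the image of a shorter prefix, whose triple steps to the
    given one. *)
Lemma branch_ind d c c' : branch d c c' -> G d c c'.
Proof.
case=> a [b [V [ab h1 h2 h3]]].
have [k] := ubnP (size V); elim: k => // k IH in a b V d c c' ab h1 h2 h3 *.
have [Y [s [eV YP]]] := trailing_zeros V; move: h1 h2 h3; rewrite eV -!catA.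
case: (eqVneq Y [::]) => [->|Y0] h1 h2 h3 sV; first exact: branch_ind_zeros h1 h2 h3.
have {YP} lY : last 0 Y != 0 by case: YP => // YE; rewrite YE in Y0.
have [|V' [z0 [eY h0 s0 dE]]] := @pref_desub_step Y s d _ h3; first by right.
have bV : all (leq^~ N) V'.
  by have := lang_bound (pref_lang h0); rewrite all_cat => /andP[].
have lY' x : last x (phi t V') != 0 by rewrite -eY; case: (Y) lY Y0.
rewrite eY in h1 h2.
have [//|//|a' [z [a'N aE h1' sz cE]]] := lang_desub_step _ _ h1.
have [//|//|b' [z' [b'N bE h2' sz' cE']]] := lang_desub_step _ _ h2.
rewrite dE cE cE'; apply: G_step => //.
- exact: pref_letter h0.
- exact: lang_letter h1'.
- exact: lang_letter h2'.
apply: (IH a' b' V') => //.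
  by apply: contra ab => /eqP; rewrite aE bE => ->.
have V0 : V' != [::] by apply: contra Y0 => /eqP V0; rewrite eY V0.
have := pref_phi_size (pref_catr h0) V0; rewrite -eY.
by move: sV; rewrite size_cat; lia.
Qed.

End BranchInduction.

(** * The criterion: the least period divides [N] *)

Section Criterion.

Hypothesis t_parry : forall k d, 0 < k -> k + d < N ->
  (forall j, j < d -> T (k + j) = T j) -> T (k + d) <= T d.

Variable p : nat.
Hypothesis p_min : min_period T N p.

Let N_gt0 : 0 < N.
Proof. lia. Qed.

Let p_gt0 : 0 < p.
Proof. exact: p_min.1.1. Qed.

Let unbordered r := min_period_unbordered N_gt0 t_parry p_min (r := r).

Lemma T_max i : i < N -> T i <= T 0.
Proof.
by case: i => // i iN; rewrite -[i.+1]addn0; apply: t_parry => //; rewrite addn0.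
Qed.

Lemma zeros_lt c : c < N -> zeros c = T c.
Proof. by rewrite /zeros => ->. Qed.

Lemma zeros_N : zeros N = (T 0).+1.
Proof. by rewrite /zeros ltnn. Qed.

Lemma next_lt s c : c < N -> next s c = if T c == s then c.+1 else 0.
Proof. by rewrite /next /zeros /after => ->. Qed.

Lemma next_N s : s <= T 0 -> next s N = 0.
Proof. by rewrite /next /zeros /after ltnn => sT; case: eqP => //; lia. Qed.

(** The prefix of length [c] of [T] is a border of the prefix of length [d]; in [ahead] the lengths
    exchange roles. *)
Definition behind d c := c < d /\ forall j, j < c -> T (d - c + j) = T j.
Definition ahead d c := d < c <= N /\ forall j, j < d -> T (c - d + j) = T j.

Lemma behind_le d c : behind d c -> d < N -> T d <= T c.
Proof.
case=> cd h dN; rewrite -{1}(subnK (ltnW cd)); apply: t_parry => //; lia.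
Qed.

Lemma behindS d c : behind d c -> T d = T c -> behind d.+1 c.+1.
Proof.
case=> cd h dc; split=> // j; rewrite ltnS leq_eqVlt subSS.
by case/orP=> [/eqP->|/h//]; rewrite -dc; congr T; lia.
Qed.

(** If [c] does not advance, it falls to 0, the empty border. *)
Lemma behind_next d c : behind d c -> d < N -> behind d.+1 (next (T d) c).
Proof.
move=> h dN; rewrite next_lt; last by case: h; lia.
by case: eqP => // e; apply: behindS.
Qed.

Lemma behind_p c : behind p c -> c = 0.
Proof. by case=> cp h; case: c cp h => // c cp /unbordered[]; lia. Qed.

Lemma ahead_le d c : ahead d c -> c < N -> T c <= T d.
Proof.
case=> /andP[dc _] h cN; rewrite -{1}(subnK (ltnW dc)); apply: t_parry => //; lia.
Qed.

Lemma aheadS d c : ahead d c -> c < N -> T d = T c -> ahead d.+1 c.+1.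
Proof.
case=> /andP[dc _] h cN e; split=> [|j]; first lia.
rewrite ltnS leq_eqVlt subSS; case/orP=> [/eqP->|/h//]; rewrite e; congr T; lia.
Qed.

(* With [N = e p + f] and [n] the length of the longest common suffix of the
   prefixes of lengths [e p] and [N], the triples run through
   [(0, ep - n, N - n)], [(0, ep, N)], [(f, N, _)] and [(p, 0, 0)]. *)
Lemma branch_not_dvd : ~~ (p %| N) -> branch p 0 0.
Proof.
rewrite /dvdn -lt0n; set f := N %% p => f0.
have fp : f < p by exact: ltn_pmod.
have pN : p < N.
  rewrite ltn_neqAle (min_period_le N_gt0 p_min) andbT; apply/eqP => pE.
  by move: f0; rewrite /f -{1}pE modnn.
have := divn_eq N p; rewrite -/f; set e := N %/ p => Ne.
have e0 : 0 < e by rewrite divn_gt0 // ltnW.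
have pe : p <= e * p by rewrite leq_pmull.
have per a i : i + a * p < N -> T (i + a * p) = T i.
  exact: (period_mul p_min.1).
have back i : i < p -> T (e * p - p + i) = T i.
  rewrite (_ : e * p - p + i = i + e.-1 * p); last by case: (e) e0 => // ? _; lia.
  by move=> ip; apply: per; case: (e) Ne e0 => // ? ? _; nia.
have forth i : i < f -> T (e * p + i) = T i by move=> h; rewrite addnC per; lia.
pose diff n := (n < f) && (T (e * p - n.+1) != T (N - n.+1)).
have ex : exists n, diff n.
  (* Without a mismatch the period would have a border of length [f]. *)
  apply: contrapT => /forallNP H; case: (@unbordered f); first lia.
  move=> i i_f; have /negP := H (f - i).-1.
  rewrite /diff prednK; last lia.
  rewrite leq_subr.
  rewrite negbK => /eqP; rewrite (_ : N - (f - i) = e * p + i); last lia.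
  by rewrite forth // => <-; rewrite -back; [congr T | ]; lia.
have [n /andP[nf nT] n_min] := ex_minnP ex.
(* Along the common suffix the last two letters advance together; [d] is the current match with the
   prefix, reset to 0 when its digit is larger. *)
have run1 j : j <= n -> exists d, [/\ d <= j,
    forall i, i < d -> T (e * p - n + j - d + i) = T i
    & branch d (e * p - n + j) (N - n + j)].
  elim: j => [_|j IH jn].
    exists 0; split=> //; rewrite !addn0.
    have eS q : n < q -> q - n = (q - n.+1).+1 by lia.
    rewrite !eS; try lia.
    move: nT; rewrite neq_ltn => /orP[] h; last apply: branch_sym;
      by apply: branch_init => //; try apply: T_max; lia.
  have [d [dj dP br]] := IH (ltnW jn).
  have TT : T (e * p - n + j) = T (N - n + j).
    apply/eqP; apply: contraT => h; have := n_min (n - j).-1.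
    rewrite /diff prednK; last lia.
    rewrite (_ : e * p - (n - j) = e * p - n + j); last lia.
    rewrite (_ : N - (n - j) = N - n + j); last lia.
    by rewrite h andbT; lia.
  have kN : e * p - n + j < N by lia.
  have lN : N - n + j < N by lia.
  have dN : d < N by lia.
  have Td : T (e * p - n + j) <= T d.
    have := @t_parry (e * p - n + j - d) d; rewrite subnK; last lia.
    by apply=> //; lia.
  have := @branch_step (T (e * p - n + j)) _ _ _ _ _ _ br.
  rewrite !zeros_lt // -TT leqnn => /(_ Td isT isT); rewrite !next_lt //.
  rewrite -TT eqxx !addnS; case: eqP => dE br'; last by exists 0.
  exists d.+1; split=> // i; rewrite ltnS subSS leq_eqVlt => /orP[/eqP->|/dP//].
  by rewrite dE; congr T; lia.
have [d [dn dP]] := run1 n (leqnn n); rewrite !subnK; try lia.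
(* A positive [d] would be a border of the least period. *)
have {dP dn} -> : d = 0.
  apply/eqP; apply: contraT; rewrite -lt0n => d0; case: (@unbordered d); first lia.
  move=> i id; rewrite -back; last lia.
  by rewrite -(dP i id); congr T; lia.
move=> br0.
(* Reading [T 0] zeros sends [N] to 0, behind the first letter; the other two advance together until
   the second reaches [N]. *)
have run2 i : i < f -> exists2 b, behind i.+1 b & branch i.+1 (e * p + i).+1 b.
  elim: i => [_|i IH i_f].
    have h0 : T (e * p) = T 0 by rewrite -[e * p]addn0 forth.
    have eN : e * p < N by lia.
    exists 0 => //; have := @branch_step (T 0) _ _ _ _ _ _ br0.
    rewrite (zeros_lt N_gt0) (zeros_lt eN) zeros_N h0 leqnn leqnSn.
    move=> /(_ isT isT isT); rewrite (next_lt _ N_gt0) (next_lt _ eN) next_N //.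
    by rewrite h0 eqxx addn0.
  have [b bP br] := IH (ltnW i_f); have iN : i.+1 < N by lia.
  have bN : b < N by case: bP; lia.
  have eN : e * p + i.+1 < N by lia.
  exists (next (T i.+1) b); first exact: behind_next.
  have := @branch_step (T i.+1) _ _ _ _ _ _ br.
  rewrite -addnS !zeros_lt // forth // leqnn => /(_ isT isT (behind_le bP iN)).
  by rewrite [next _ i.+1]next_lt // eqxx [next _ (_ + _)]next_lt // forth // eqxx.
(* Now the second letter falls from [N] to 0; both stay behind the first, and at [p] only the empty
   border is left. *)
have run3 i : f <= i < p -> exists a b,
    [/\ behind i.+1 a, behind i.+1 b & branch i.+1 a b].
  elim: i => [|i IH]; first lia.
  case/andP; rewrite leq_eqVlt => /orP[/eqP fE ip|fi ip]; last first.
    have [|a [b [aP bP br]]] := IH; first lia.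
    have iN : i.+1 < N by lia.
    exists (next (T i.+1) a), (next (T i.+1) b); split; try exact: behind_next.
    have := @branch_step (T i.+1) _ _ _ _ _ _ br.
    rewrite (zeros_lt iN) leqnn !zeros_lt; try by [case: aP; lia | case: bP; lia].
    move=> /(_ isT (behind_le aP iN) (behind_le bP iN)).
    by rewrite [next _ i.+1]next_lt // eqxx.
  have iN : i.+1 < N by lia.
  have [|b bP br] := run2 i; first lia.
  exists 0, (next (T i.+1) b); split=> //; first exact: behind_next.
  have := @branch_step (T i.+1) _ _ _ _ _ _ br.
  rewrite -addnS -fE -Ne fE (zeros_lt iN) leqnn zeros_N.
  rewrite zeros_lt; last by case: bP; lia.
  have Ti := T_max iN; move=> /(_ isT (leqW Ti) (behind_le bP iN)).
  by rewrite next_N // [next _ i.+1]next_lt // eqxx.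
have [|a [b []]] := run3 p.-1; first lia.
by rewrite prednK // => /behind_p-> /behind_p->.
Qed.

(* The mismatching letter [c] stays ahead of [d] by a non-multiple of [p], so
   it never becomes [N] and never yields more zeros than [d]. *)
Definition separated d c c' := [/\ ahead d c, ~~ (p %| c - d)
  & behind d c' \/ ahead d c' /\ (c %% p != c' %% p)].

(** The invariant for [branch_ind]: [separated] fails when its last two letters agree, so on
    [(d, e, e)] it forces [d = e]. *)
Definition good d c c' :=
  c = d \/ c' = d \/ separated d c c' \/ separated d c' c.

Lemma good_sym d c c' : good d c c' -> good d c' c.
Proof. by rewrite /good; tauto. Qed.

Lemma ahead0 c : 0 < c <= N -> ahead 0 c.
Proof. by []. Qed.

Lemma modS_neq c c' : c %% p != c' %% p -> c.+1 %% p != c'.+1 %% p.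
Proof. by rewrite -[c.+1]addn1 -[c'.+1]addn1 eqn_modDr. Qed.

(** With distinct residues, at most one of [c.+1] and [c'.+1] is a multiple of [p]; the other
    becomes the separated letter. *)
Lemma good_restart c c' :
  c < N -> c' < N -> c %% p != c' %% p -> good 0 c.+1 c'.+1.
Proof.
move=> cN cN' /modS_neq h; right; right.
case: (boolP (p %| c.+1)) => hc; last by left; split=> //; right.
right; split; [exact: ahead0 | | right; split; [exact: ahead0 | by rewrite eq_sym]].
by apply: contra h; rewrite subn0 /dvdn (eqP hc) => /eqP->.
Qed.

(** If [c = N], the first [d] letters also end the word; as [p] divides [N] but not [d], the period
    has a border of length [d %% p]. *)
Lemma ahead_lt_N d c : p %| N -> ahead d c -> ~~ (p %| c - d) -> c < N.
Proof.
move=> pN [/andP[dc cN] h] nd; rewrite ltn_neqAle cN andbT; apply/eqP => cE.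
have rp := ltn_pmod d p_gt0.
have r0 : 0 < d %% p.
  rewrite lt0n; apply: contra nd => rd.
  by rewrite dvdn_subr // ?cE // -cE ltnW.
have eN := divnK pN; have eD := divn_eq d p.
have q0 : 0 < N %/ p by rewrite divn_gt0 // dvdn_leq.
case: (@unbordered (d %% p)) => [|i ir]; first lia.
have e1 : T (N - d + (i + d %/ p * p)) = T (i + d %/ p * p).
  by rewrite -cE; apply: h; lia.
rewrite -(@period_mul T N p (d %/ p) i p_min.1); last lia.
rewrite -e1 -(@period_mul T N p (N %/ p).-1 (p - d %% p + i) p_min.1).
  by congr T; move: eN; case: (N %/ p) q0 => // q _; rewrite mulSn /=; lia.
by move: eN; case: (N %/ p) q0 => // q _; rewrite mulSn /=; lia.
Qed.

Lemma separated_step s d c c' :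
  p %| N -> c' <= N -> s <= zeros d -> s <= zeros c -> s <= zeros c' ->
  separated d c c' -> good (next s d) (next s c) (next s c').
Proof.
move=> pN cN' sd sc sc' [ac nd hc'].
have cN := ahead_lt_N pN ac nd; have Tcd := ahead_le ac cN.
have dc : d < c by case: ac => /andP[].
have dN : d < N by lia.
move: sd sc; rewrite !zeros_lt // => sd sc.
rewrite (next_lt _ dN) (next_lt _ cN).
case: (ltnP s (T c)) => scs.
  (* Here [s < T c <= T d], so [c] and [d] both fall to 0. *)
  by left; do 2 (case: eqP => [?|_]; first lia).
have {scs} sE : s = T c by lia.
have N_c' : zeros c' = s -> c' < N.
  move: cN'; rewrite leq_eqVlt => /orP[/eqP->|//]; rewrite /zeros ltnn.
  by have := T_max cN; lia.
have n_c' : zeros c' <> s -> next s c' = 0 by rewrite /next; case: eqP.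
rewrite -sE eqxx.
case: (eqVneq (T d) s) => [dE|dE].
  right; right; left; split; [by apply: aheadS => //; lia | by rewrite subSS |].
  case: (zeros c' =P s) => zc'; last by left; rewrite n_c'.
  have c'N := N_c' zc'; move: zc'; rewrite zeros_lt // next_lt // => zc'.
  rewrite zc' eqxx; case: hc' => [hb|[ha hm]].
    by left; apply: behindS => //; rewrite zc'.
  by right; split; [apply: aheadS => //; rewrite zc' | exact: modS_neq].
(* Here [d] restarts at 0 while [c] advances. If [c'] advances too, it is not behind [d], and the
   residues of [c] and [c'] differ. *)
case: (zeros c' =P s) => zc'; last by right; left; rewrite n_c'.
have c'N := N_c' zc'; move: zc'; rewrite zeros_lt // next_lt // => zc'.
rewrite zc' eqxx; case: hc' => [/behind_le/(_ dN)|[ha hm]]; first lia.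
exact: good_restart.
Qed.

Lemma branch_dvd d e : p %| N -> branch d e e -> d = e.
Proof.
move=> pN br.
have nsep : ~ separated d e e.
  by case=> [[/andP[de _] _] _ [[]|[_ /eqP]]] //; lia.
suff : good d e e by case=> [->|[->|[]]].
apply: branch_ind br.
- exact: T_max.
- exact: good_sym.
- by left.
(* Equal residues modulo the period would give equal digits. *)
- move=> k l kN lN kl; apply: good_restart => //; apply/eqP => klp.
  by apply: kl; rewrite -(period_mod p_min.1 kN) klp (period_mod p_min.1 lN).
- move=> s x c c' xN cN cN' sx sc sc' [->|[->|[h|h]]].
  + by left.
  + by right; left.
  + exact: separated_step.
  + by apply: good_sym; exact: separated_step.
Qed.

Lemma left_special_pref_dvd : left_special_pref <-> p %| N.
Proof.
split=> [/left_special_prefP H|pN].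
  by apply: contraT => /branch_not_dvd/H; lia.
by apply/left_special_prefP => d e; exact: branch_dvd.
Qed.

End Criterion.

End Language.

(** * Translation between digit indices and words *)

Lemma parry_cond_le t k d :
  parry_cond t -> 0 < k < size t ->
  (forall j, j < d -> nth 0 t (k + j) = nth 0 t j) ->
  nth 0 t (k + d) <= nth 0 t d.
Proof.
move=> parry kt h; have [|q [qE]] := parry k.+1; first lia.
rewrite /pad0 /= nth_drop => qlt.
case: (ltngtP d q) => [dq|qd|->]; last exact: ltnW.
  by have := qE d dq; rewrite /pad0 /= nth_drop => ->.
by move: qlt; rewrite h // ltnn.
Qed.

Lemma flatten_nseqSr (A : Type) k (w : seq A) :
  flatten (nseq k.+1 w) = flatten (nseq k w) ++ w.
Proof. by rewrite nseqSr flatten_rcons. Qed.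

Lemma power_period t N k w :
  take N t = flatten (nseq k w) -> 0 < size w -> N <= size t ->
  period (nth 0 t) N (size w).
Proof.
move=> e w0 Nt; split=> // i iN.
have TE j : j < N -> nth 0 t j = nth 0 (flatten (nseq k w)) j.
  by move=> jN; rewrite -e nth_take.
have := congr1 size e; rewrite size_takel // size_flatten /shape map_nseq sumn_nseq.
move=> sE; rewrite !TE //; last lia.
case: k {e TE} sE => [|k] sE; first lia.
rewrite {2}flatten_nseqSr nth_cat /= nth_cat ltnNge leq_addl addnK /=.
by rewrite size_flatten /shape map_nseq sumn_nseq; case: ltnP => //; lia.
Qed.

Lemma period_power t N p k :
  period (nth 0 t) N p -> N <= size t -> k * p <= N ->
  take (k * p) t = flatten (nseq k (take p t)).
Proof.
move=> pP Nt; elim: k => [|k IH] kN; first by rewrite take0.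
rewrite flatten_nseqSr -IH; last lia.
rewrite mulSnr takeD; congr (_ ++ _); apply: (@eq_from_nth _ 0).
  by rewrite !size_takel ?size_drop; lia.
move=> i; rewrite size_takel ?size_drop; last lia.
move=> ip; rewrite !nth_take // nth_drop addnC (period_mul pP) //; lia.
Qed.

Lemma borderP (t v : seq nat) N :
  N <= size t -> size v <= N ->
  prefix v (take N t) /\ suffix v (take N t) <->
  v = take (size v) t /\
  forall i, i < size v -> nth 0 t (N - size v + i) = nth 0 t i.
Proof.
move=> Nt vN; have sN : size (take N t) = N by rewrite size_takel.
rewrite prefixE suffixE sN take_takel //; split=> [[/eqP pv /eqP sv]|[pv h]].
  split=> // i iv; have iN : N - size v + i < N by lia.
  have := congr1 (fun s => nth 0 s i) sv; rewrite nth_drop nth_take //.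
  by move->; rewrite -{1}pv nth_take.
rewrite -pv eqxx; split=> //; apply/eqP/(@eq_from_nth _ 0).
  by rewrite size_drop sN subKn.
move=> i; rewrite size_drop sN subKn // => iv.
have iN : N - size v + i < N by rewrite -[ltnRHS](subnK vN) ltn_add2l.
by rewrite nth_drop nth_take // h // [in RHS]pv nth_take.
Qed.

Theorem theorem1 (R : realType) (beta : R) (t : seq nat) :
  2 <= size t ->
  renyi_expansion_of_one beta t ->
  (exists a b : int, forall n : nat,
      ((complexity t n)%:Z = a * n%:Z + b)%R)
  <->
  (last 0 t = 1 /\
   ((exists (w : seq nat) (k : nat),
        2 <= k /\ take (size t).-1 t = flatten (nseq k w))
    \/
    (forall v : seq nat,
        0 < size v < (size t).-1 ->
        ~ (prefix v (take (size t).-1 t) /\ suffix v (take (size t).-1 t))))).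
Proof.
move=> size_t [_ _ [t_head t_last] _ parry].
rewrite affine_complexity //; set N := (size t).-1.
have N_gt0 : 0 < N by rewrite /N; lia.
have Nt : N <= size t by rewrite /N; lia.
have t_parry k d : 0 < k -> k + d < N ->
    (forall j, j < d -> nth 0 t (k + j) = nth 0 t j) ->
    nth 0 t (k + d) <= nth 0 t d.
  by move=> k0 kd; apply: parry_cond_le => //; rewrite /N in kd; lia.
have [p p_min] := min_period_exists (nth 0 t) N_gt0.
have LSP : left_special_pref t <-> last 0 t = 1 /\ p %| N.
  split=> [h|[t1 pN]].
    have t1 := left_special_pref_last size_t t_head t_last h; split=> //.
    by apply/(left_special_pref_dvd size_t t_head t_last t1 t_parry p_min).
  by apply/(left_special_pref_dvd size_t t_head t_last t1 t_parry p_min).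
rewrite LSP; split=> -[t1 h]; split=> //.
  have [pN|unb] := dvd_min_period N_gt0 t_parry p_min h; [left | right].
    exists (take p t), (N %/ p); split; last first.
      by rewrite -(period_power p_min.1) ?divnK.
    (* The quotient is at least 2 because [0 < p < N]. *)
    have := divnK h; case: (N %/ p) => [|[|//]]; lia.
  move=> v vN bv; apply: (unb _ vN).
  by case/borderP: bv => //; case/andP: vN => _ /ltnW.
apply: (min_period_dvd N_gt0 t_parry p_min).
case: h => [[w [k [k2 e]]]|unb]; [left | right].
  have := congr1 size e; rewrite size_takel // size_flatten /shape map_nseq sumn_nseq.
  (* [w] is non-empty as [N > 0], and [k >= 2] fits two copies of it into [N]. *)
  move=> sE; exists (size w).
    by apply: (power_period e) => //; case: (size w) sE => //; lia.
  by rewrite sE dvdn_mulr //=; nia.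
move=> r rN rP; have rt : size (take r t) = r by rewrite size_takel //; lia.
apply: (unb (take r t)); rewrite ?rt //.
by apply/borderP => //; rewrite rt; [lia | split].
Qed.
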